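(* Let $S=K[X_1,\ldots,X_n]$ be the polynomial ring in $n$ variables over a field $K$ of characteristic $p>0$. Let $I\subset S$ be an ideal and $<$ a monomial order on $S$. If $\mathrm{in}_<(I^{[p]}:I)$ contains $X_1^{p-1}\cdots X_n^{p-1}$, then $\mathrm{in}_<(I)$ is a squarefree monomial ideal.
   Context: For an ideal $J\subset S$ and a monomial order $<$, $\mathrm{in}_<(J)$ is the ideal generated by the initial monomials $\mathrm{in}_<(f)$ of the elements $f\in J$. $I^{[p]}=(x^p : x\in I)$, and $I^{[p]}:I=\{f\in S : fI\subset I^{[p]}\}$. A squarefree monomial ideal is an ideal generated by squarefree monomials. *)

(* Defs.v *)
From HB Require Import structures.
From mathcomp Require Import all_boot all_order all_algebra.
From mathcomp Require Import mpoly.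

Set Implicit Arguments.
Unset Strict Implicit.
Unset Printing Implicit Defensive.

Import GRing.Theory.

Local Open Scope ring_scope.

(* Ideals are Prop-valued predicates, so that no decidability of membership is
   assumed and the unit ideal is allowed (unlike idealr_closed in
   ring_quotient, which is boolean and requires ideals to be proper). *)
Definition is_ideal (R : comNzRingType) (J : R -> Prop) : Prop :=
  [/\ J 0, forall x y, J x -> J y -> J (x + y)
         & forall a x, J x -> J (a * x)].

Definition ideal_gen (R : comNzRingType) (G : R -> Prop) (f : R) : Prop :=
  exists (k : nat) (a g : 'I_k -> R),
    (forall i, G (g i)) /\ f = \sum_(i < k) a i * g i.

(* I^[p] *)
Definition frobenius_power (R : comNzRingType) (p : nat) (I : R -> Prop) :
    R -> Prop :=
  ideal_gen (fun y => exists2 x, I x & y = x ^+ p).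

(* J : I *)
Definition colon (R : comNzRingType) (J I : R -> Prop) (f : R) : Prop :=
  forall g, I g -> J (f * g).

(* Monomials are identified with their exponent vectors, so the product of
   monomials is the sum in 'X_{1..n} and the monomial 1 is 0%MM. Reflexivity
   follows from totality. *)
Definition monomial_order (n : nat) (le : rel 'X_{1..n}) : Prop :=
  [/\ antisymmetric le, transitive le, total le,
      forall m, le 0%MM m
    & forall m1 m2 m, le m1 m2 -> le (m1 + m)%MM (m2 + m)%MM].

(* m is the exponent of in_<(f); there is no such m when f = 0. The library's
   mlead is not used because it is tied to one fixed order. *)
Definition is_initial (K : fieldType) (n : nat) (le : rel 'X_{1..n})
    (f : {mpoly K[n]}) (m : 'X_{1..n}) : Prop :=
  m \in msupp f /\ forall m', m' \in msupp f -> le m' m.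

(* in_<(J) *)
Definition initial_ideal (K : fieldType) (n : nat) (le : rel 'X_{1..n})
    (J : {mpoly K[n]} -> Prop) : {mpoly K[n]} -> Prop :=
  ideal_gen (fun g => exists f m, [/\ J f, is_initial le f m & g = 'X_[m]]).

Definition squarefree_mnm (n : nat) (m : 'X_{1..n}) : Prop :=
  forall i : 'I_n, (m i <= 1)%N.

Definition squarefree_monomial_ideal (K : fieldType) (n : nat)
    (J : {mpoly K[n]} -> Prop) : Prop :=
  exists M : 'X_{1..n} -> Prop,
    (forall m, M m -> squarefree_mnm m) /\
    (forall f, J f <-> ideal_gen (fun g => exists2 m, M m & g = 'X_[m]) f).

(* Main.v *)
Require Import Defs.
From HB Require Import structures.
From mathcomp Require Import all_boot all_order all_algebra.
From mathcomp Require Import mpoly.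

Set Implicit Arguments.
Unset Strict Implicit.
Unset Printing Implicit Defensive.

Import GRing.Theory.

Local Open Scope ring_scope.

(** Write rho = (p-1, ..., p-1).  The hypothesis provides f in I^[p] : I with
    initial exponent rho: an initial exponent dividing rho can be raised to rho
    by multiplying f by a monomial.  The heart of the proof is that the set of
    initial exponents of I is closed under division by p: if p u is the
    initial exponent of g in I, then u is the initial exponent of some element
    of I ([initial_exponent_root]).  Since an initial exponent m satisfies
    m <= p^e r for its squarefree radical r and some e, the exponent p^e r is
    initial as well, and dividing by p repeatedly shows that r is initial
    ([initial_exponent_radical]).  So in(I) is generated by its squarefree
    monomials.

    For the division by p, observe that fg lies in I^[p] and has initial
    exponent rho + p u.  If K were perfect one would apply the trace map, the
    additive map with T(c X^(rho + p a)) = c^(1/p) X^a killing all other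
    monomials: it satisfies T(y^p z) = y T(z), so it sends I^[p] into I, and
    it preserves the order of exponents, so T(fg) has initial exponent u.

    Over an arbitrary K the p-th roots of the coefficients need not exist.
    Only the exponents are divided by p, while the coefficients stay put: the
    polynomial H whose coefficient at a is that of fg at rho + p a is then a
    K-linear combination of Frobenius twists h^sigma of elements h of I, where
    sigma(c) = c^p acts on coefficients ([frobenius_power_span]).  That some
    combination of the h^sigma has initial exponent u says that a linear
    system with coefficients in the subfield sigma(K) is solvable over K.  It
    is then solvable over sigma(K) ([frobenius_descent]), and untwisting a
    solution gives a combination of the h themselves, an element of I, with
    initial exponent u ([initial_frobenius_span]). *)

(** * Ideals and their generators *)

Lemma ideal_sum (R : comNzRingType) (J : R -> Prop) (hJ : is_ideal J)
    (T : Type) (r : seq T) (P : pred T) (F : T -> R) :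
  (forall i, P i -> J (F i)) -> J (\sum_(i <- r | P i) F i).
Proof. by case: hJ => J0 JD _ hF; apply: big_ind. Qed.

Lemma ideal_gen_ideal (R : comNzRingType) (G : R -> Prop) :
  is_ideal (ideal_gen G).
Proof.
split.
- by exists 0%N, (fun _ => 0), (fun _ => 0); split=> [[]|] //; rewrite big_ord0.
- move=> x y [k [a [g [Gg ->]]]] [l [b [h [Gh ->]]]].
  pose pick T (u : 'I_k -> T) (v : 'I_l -> T) (i : 'I_(k + l)) :=
    match split i with inl j => u j | inr j => v j end.
  exists (k + l)%N, (pick R a b), (pick R g h); split=> [i|].
    by rewrite /pick; case: (split i).
  rewrite big_split_ord /=; congr (_ + _); apply: eq_bigr => i _.
    by rewrite /pick -/(unsplit (inl i)) unsplitK.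
  by rewrite /pick -/(unsplit (inr i)) unsplitK.
- move=> c x [k [a [g [Gg ->]]]]; exists k, (fun i => c * a i), g; split=> //.
  by rewrite mulr_sumr; apply: eq_bigr => i _; rewrite mulrA.
Qed.

Lemma ideal_gen_min (R : comNzRingType) (G J : R -> Prop) (hJ : is_ideal J)
    (f : R) :
  (forall g, G g -> J g) -> ideal_gen G f -> J f.
Proof.
move=> GJ [k [a [g [Gg ->]]]]; apply: ideal_sum => // i _.
by case: hJ => _ _; apply; apply: GJ.
Qed.

Lemma ideal_gen_sub (R : comNzRingType) (G : R -> Prop) (g : R) :
  G g -> ideal_gen G g.
Proof.
by move=> Gg; exists 1%N, (fun _ => 1), (fun _ => g); rewrite big_ord1 mul1r.
Qed.

Lemma colon_ideal (R : comNzRingType) (J I : R -> Prop) (hJ : is_ideal J) :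
  is_ideal (colon J I).
Proof.
case: hJ => J0 JD JM; split=> [g _|x y hx hy g Ig|a x hx g Ig].
- by rewrite mul0r.
- by rewrite mulrDl; apply: JD; [apply: hx|apply: hy].
- by rewrite -mulrA; apply: JM; apply: hx.
Qed.

(** * Initial exponents for a monomial order *)

Lemma mcoeffXM (R : comNzRingType) (n : nat) (g : {mpoly R[n]})
    (m k : 'X_{1..n}) :
  ('X_[m] * g)@_k = \sum_(b <- msupp g) g@_b * ((m + b)%MM == k)%:R.
Proof.
rewrite {1}[g]mpolyE mulr_sumr raddf_sum /=; apply: eq_bigr => b _.
by rewrite -scalerAr -mpolyXD mcoeffZ mcoeffX.
Qed.

Definition initial_exponent (K : fieldType) (n : nat) (le : rel 'X_{1..n})
    (J : {mpoly K[n]} -> Prop) (m : 'X_{1..n}) : Prop :=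
  exists2 f, J f & is_initial le f m.

Section MonomialOrder.
Context (K : fieldType) (n : nat) (le : rel 'X_{1..n}).
Context (hle : monomial_order le).

(** Cancellation follows from compatibility with addition because the order is
    total and antisymmetric. *)
Lemma monomial_order_addI (m1 m2 m : 'X_{1..n}) :
  le (m1 + m)%MM (m2 + m)%MM -> le m1 m2.
Proof.
case: hle => anti _ tot _ cmp h.
have [//|/(cmp _ _ m) h'] := orP (tot m1 m2).
have /(@addIm _ m) <- : (m1 + m = m2 + m)%MM by apply: anti; rewrite h h'.
by case/orP: (tot m1 m1).
Qed.

Lemma monomial_order_muln (m1 m2 : 'X_{1..n}) (k : nat) :
  le m1 m2 -> le (m1 *+ k)%MM (m2 *+ k)%MM.
Proof.
case: hle => _ tr tot _ cmp h; elim: k => [|k IH].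
  by rewrite !mulm0n; case/orP: (tot 0%MM 0%MM).
rewrite !mulmS; apply: (tr (m2 + m1 *+ k)%MM); first exact: cmp.
by rewrite ![(m2 + _)%MM]addmC; apply: cmp.
Qed.

Lemma monomial_order_mulnI (m1 m2 : 'X_{1..n}) (k : nat) :
  (0 < k)%N -> le (m1 *+ k)%MM (m2 *+ k)%MM -> le m1 m2.
Proof.
move=> k0 h; case: (hle) => anti _ tot _ _.
have [//|/(monomial_order_muln k) h'] := orP (tot m1 m2).
have /mnmP e : (m1 *+ k = m2 *+ k)%MM by apply: anti; rewrite h h'.
have -> : m1 = m2.
  apply/mnmP => i; have /eqP := e i; rewrite !mulmnE eqn_pmul2r // => /eqP //.
by case/orP: (tot m2 m2).
Qed.

Lemma is_initialM (f g : {mpoly K[n]}) (m k : 'X_{1..n}) :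
  is_initial le f m -> is_initial le g k -> is_initial le (f * g) (m + k)%MM.
Proof.
case: (hle) => anti tr _ _ cmp [fm fle] [gk gle]; split; last first.
  move=> x /msuppM_le /allpairsP [[a b] /= [/fle ha /gle hb ->]].
  apply: (tr (m + b)%MM); first exact: cmp.
  by rewrite ![(m + _)%MM]addmC; apply: cmp.
(* a + b = m + k with a <= m and b <= k forces a = m and b = k, so a single
   product of terms contributes to the top coefficient. *)
have coef_lead a : a \in msupp f -> a != m -> ('X_[a] * g)@_(m + k) = 0.
  move=> /fle ham /eqP nam; rewrite mcoeffXM big_seq big1 // => b /gle hbk.
  case: eqP => [e|_]; last by rewrite mulr0.
  case: nam; apply: anti; rewrite ham /=.
  apply: (@monomial_order_addI _ _ k); rewrite -e ![(a + _)%MM]addmC.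
  exact: cmp.
rewrite mcoeff_msupp {1}[f]mpolyE mulr_suml raddf_sum /=.
rewrite (bigD1_seq m) ?msupp_uniq //= big_seq_cond big1 ?addr0.
  rewrite -scalerAl mcoeffZ [_ * g]mulrC mcoeffMX.
  by rewrite mulf_neq0 // -mcoeff_msupp.
by move=> a /andP[fa am]; rewrite -scalerAl mcoeffZ coef_lead ?mulr0.
Qed.

Lemma is_initialX (m : 'X_{1..n}) : is_initial le ('X_[m] : {mpoly K[n]}) m.
Proof.
case: hle => _ _ tot _ _; rewrite /is_initial msuppX mem_seq1 eqxx.
by split=> // m'; rewrite mem_seq1 => /eqP ->; case/orP: (tot m m).
Qed.

Lemma initial_exponent_le (J : {mpoly K[n]} -> Prop) (hJ : is_ideal J)
    (m k : 'X_{1..n}) :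
  (m <= k)%MM -> initial_exponent le J m -> initial_exponent le J k.
Proof.
move=> mk [f Jf fm]; exists ('X_[k - m] * f).
  by case: hJ => _ _; apply.
by rewrite -[X in is_initial _ _ X](submK mk); apply: is_initialM => //;
   apply: is_initialX.
Qed.

(** A monomial lying in a monomial ideal is a multiple of one of the
    generators, because it has to occur in some term a_i g_i. *)
Lemma initial_ideal_exponent (J : {mpoly K[n]} -> Prop) (hJ : is_ideal J)
    (m : 'X_{1..n}) :
  initial_ideal le J 'X_[m] -> initial_exponent le J m.
Proof.
move=> [k [a [g [hg e]]]].
have: m \in msupp ('X_[m] : {mpoly K[n]}) by rewrite msuppX mem_seq1.
rewrite e => /msupp_sum_le /flattenP[_ /mapP[i _ ->]].
case: (hg i) => f [l [Jf fl ->]] /msuppM_le /allpairsP[[b c] /= [_]].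
rewrite msuppX mem_seq1 => /eqP -> ->.
apply: (@initial_exponent_le _ _ l) => //; last by exists f.
by apply/mnm_lepP => j; rewrite mnmDE leq_addl.
Qed.

End MonomialOrder.

(** * Squarefree radicals of monomials *)

Definition radical_mnm (n : nat) (m : 'X_{1..n}) : 'X_{1..n} :=
  [multinom ((m i != 0) : nat) | i < n].

Lemma radical_mnm_squarefree (n : nat) (m : 'X_{1..n}) :
  squarefree_mnm (radical_mnm m).
Proof. by move=> i; rewrite mnmE leq_b1. Qed.

Lemma radical_mnm_le (n : nat) (m : 'X_{1..n}) : (radical_mnm m <= m)%MM.
Proof. by apply/mnm_lepP => i; rewrite mnmE; case: (m i). Qed.

(** * The exponents (p-1, ..., p-1) + p a *)

(** The monomials with such exponents are those that the trace map of the
    Frobenius does not kill. *)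
Definition frobenius_exponent (n p : nat) (a : 'X_{1..n}) : 'X_{1..n} :=
  [multinom (p.-1 + a i * p)%N | i < n].

Section Frobenius.
Context (K : fieldType) (p : nat) (hp : p \in [pchar K]) (n : nat).

Let p_gt0 : (0 < p)%N. Proof. exact: prime_gt0 (pcharf_prime hp). Qed.

Lemma frobenius_exponentD (a b : 'X_{1..n}) :
  frobenius_exponent p (a + b)%MM = (frobenius_exponent p a + b *+ p)%MM.
Proof. by apply/mnmP => i; rewrite !mnmE mulmnE mulnDl addnA. Qed.

Lemma frobenius_exponent_inj : injective (@frobenius_exponent n p).
Proof.
move=> a b /mnmP e; apply/mnmP => i; have /eqP := e i.
by rewrite !mnmE eqn_add2l eqn_pmul2r // => /eqP.
Qed.

Lemma mpoly_exp_pchar (g : {mpoly K[n]}) :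
  g ^+ p = \sum_(b <- msupp g) g@_b ^+ p *: 'X_[b *+ p].
Proof.
have hP : p \in [pchar {mpoly K[n]}] by rewrite pchar_lalg.
rewrite {1}[g]mpolyE -(pFrobenius_autE hP) raddf_sum /=.
by apply: eq_bigr => b _; rewrite pFrobenius_autE exprZn mpolyXn.
Qed.

(** This is the identity T(X^(rho + p b) g^p) = X^b g for the trace map, with both
    sides raised to the power p so that no p-th root is taken. *)
Lemma mcoeff_monomial_frobenius (g : {mpoly K[n]}) (b a : 'X_{1..n}) :
  ('X_[frobenius_exponent p b] * g ^+ p)@_(frobenius_exponent p a)
  = ('X_[b] * g)@_a ^+ p.
Proof.
rewrite [in RHS]mcoeffXM -(pFrobenius_autE hp) raddf_sum.
rewrite mpoly_exp_pchar mulr_sumr.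
rewrite raddf_sum /=; apply: eq_bigr => c _.
rewrite -scalerAr -mpolyXD mcoeffZ mcoeffX -frobenius_exponentD.
rewrite (inj_eq frobenius_exponent_inj) rmorphM /= !pFrobenius_autE.
by case: eqP; rewrite ?expr1n ?expr0n // gtn_eqF.
Qed.

(** Multiplying by g^p does not change exponents modulo p, so a monomial that
    is not of the form X^(rho + p b) stays away from all such exponents. *)
Lemma mcoeff_monomial_frobenius0 (g : {mpoly K[n]}) (m a : 'X_{1..n}) :
  (forall b, m <> frobenius_exponent p b) ->
  ('X_[m] * g ^+ p)@_(frobenius_exponent p a) = 0.
Proof.
move=> hm; rewrite mpoly_exp_pchar mulr_sumr raddf_sum /= big1 // => c _.
rewrite -scalerAr -mpolyXD mcoeffZ mcoeffX.
case: eqP => [/mnmP e|_]; last by rewrite mulr0.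
case: (hm [multinom (m i %/ p)%N | i < n]); apply/mnmP => i.
have := e i; rewrite !mnmE mulmnE => /(congr1 (modn^~ p)) /=.
rewrite [(m i + _)%N]addnC [(_ + a i * p)%N]addnC !modnMDl.
by rewrite (@modn_small p.-1) ?prednK // => <-; rewrite addnC -divn_eq.
Qed.

(** * Descent along the Frobenius *)

(** The substitute for the condition T(y) in I: the coefficients of y at the
    exponents rho + p a form a polynomial in the K-span of the Frobenius twists
    of elements of I. *)
Definition frobenius_span (I : {mpoly K[n]} -> Prop) (y : {mpoly K[n]}) : Prop :=
  exists s : seq (K * {mpoly K[n]}),
    (forall x, x \in s -> I x.2) /\
    (forall a, y@_(frobenius_exponent p a)
               = \sum_(x <- s) x.1 * (x.2)@_a ^+ p).

Lemma frobenius_span_sum (I : {mpoly K[n]} -> Prop) (T : Type) (r : seq T)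
    (F : T -> {mpoly K[n]}) :
  (forall i, frobenius_span I (F i)) ->
  frobenius_span I (\sum_(i <- r) F i).
Proof.
move=> hF; apply: (big_ind (frobenius_span I)) => //.
  by exists [::]; split=> // a; rewrite big_nil mcoeff0.
move=> x y [s [Is es]] [t [It et]]; exists (s ++ t); split=> [z|a].
  by rewrite mem_cat => /orP[/Is|/It].
by rewrite mcoeffD es et big_cat.
Qed.

(** I^[p] is spanned over K by the products X^m g^p with g in I.  For
    m = rho + p b such a product contributes the twist of X^b g, and for any
    other m it contributes nothing. *)
Lemma frobenius_power_span (I : {mpoly K[n]} -> Prop) (hI : is_ideal I)
    (y : {mpoly K[n]}) :
  frobenius_power p I y -> frobenius_span I y.
Proof.
move=> [k [c [h [hh ->]]]]; apply: frobenius_span_sum => i.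
have [g Ig ->] := hh i.
rewrite [c i]mpolyE mulr_suml; apply: frobenius_span_sum => m.
rewrite -scalerAl; case: (eqVneq m
    (frobenius_exponent p [multinom (m i %/ p)%N | i < n])) => [->|nm].
  set b := [multinom _ | _ < n]; exists [:: ((c i)@_(frobenius_exponent p b),
    'X_[b] * g)]; split=> [x|a].
    by rewrite mem_seq1 => /eqP -> /=; case: hI => _ _; apply.
  by rewrite big_seq1 mcoeffZ mcoeff_monomial_frobenius.
exists [::]; split=> // a; rewrite big_nil mcoeffZ mcoeff_monomial_frobenius0.
  by rewrite mulr0.
move=> b e; case/eqP: nm; apply/mnmP => j.
rewrite {1}e !mnmE e mnmE addnC divnMDl // divn_small ?prednK //.
by rewrite addn0 addnC.
Qed.

(** Row-space membership between matrices over sigma(K), the image of the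
    Frobenius, does not depend on whether coefficients are taken in sigma(K) or
    in K.  The target, a unit vector supported at u, is fixed by sigma.  Hence
    if it is a combination of the twisted rows, it is a combination of the
    rows themselves. *)
Lemma frobenius_descent (s : seq (K * {mpoly K[n]})) (T : seq 'X_{1..n})
    (u : 'X_{1..n}) (c : K) :
  c != 0 -> (forall a, a \in T -> \sum_(x <- s) x.1 * (x.2)@_a ^+ p
                                 = c * (a == u)%:R) ->
  exists d : 'I_(size s) -> K,
    forall a, a \in T ->
      (\sum_i d i *: (tnth (in_tuple s) i).2)@_a = (a == u)%:R.
Proof.
move=> c0 hs; pose x i := tnth (in_tuple s) i; pose t j := tnth (in_tuple T) j.
pose A := \matrix_(i < size s, j < size T) (x i).2@_(t j).
pose D := \row_(j < size T) ((t j == u)%:R : K).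
have /submxP[d hd] : (D <= A)%MS.
  rewrite -(map_submx (pFrobenius_aut hp)).
  apply/submxP; exists (\row_i (c^-1 * (x i).1)).
  apply/rowP => j; rewrite !mxE.
  have := hs (t j) (mem_tnth _ _).
  rewrite big_tnth => /(congr1 ( *%R c^-1)); rewrite mulKf // mulr_sumr => e.
  rewrite rmorph_nat -e; apply: eq_bigr => i _.
  by rewrite !mxE -mulrA.
exists (fun i => d 0 i) => a /(tnthP (in_tuple T)) [j ->].
rewrite -/(t j); move/rowP/(_ j): hd; rewrite !mxE => ->.
by rewrite raddf_sum /=; apply: eq_bigr => i _; rewrite mcoeffZ mxE.
Qed.

Section Order.
Context (le : rel 'X_{1..n}) (hle : monomial_order le).

Lemma frobenius_exponent_le (a b : 'X_{1..n}) :
  le (frobenius_exponent p a) (frobenius_exponent p b) -> le a b.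
Proof.
rewrite -[a]add0m -[b]add0m !frobenius_exponentD !add0m.
rewrite ![(frobenius_exponent p 0 + _)%MM]addmC.
by move/(monomial_order_addI hle)/(monomial_order_mulnI hle); apply.
Qed.

(** Having initial exponent u amounts to finitely many linear conditions on a
    combination of the h in s: a nonzero coefficient at u, and a zero one at the
    exponents not below u that occur in some h.  These conditions descend along
    the Frobenius. *)
Lemma initial_frobenius_span (I : {mpoly K[n]} -> Prop) (hI : is_ideal I)
    (y : {mpoly K[n]}) (u : 'X_{1..n}) :
  frobenius_span I y -> is_initial le y (frobenius_exponent p u) ->
  initial_exponent le I u.
Proof.
move=> [s [Is es]] [yu yle].
pose T := u :: [seq a <- flatten [seq msupp x.2 | x <- s] | ~~ le a u].
have leuu : le u u by case: hle => _ _ tot _ _; case/orP: (tot u u).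
have [||d hd] := @frobenius_descent s T u (y@_(frobenius_exponent p u)).
- by rewrite -mcoeff_msupp.
- move=> a; rewrite -es inE mem_filter.
  case: eqVneq => [->|au] /=; first by rewrite mulr1.
  move=> /andP[nle _]; rewrite mulr0; apply/eqP; rewrite mcoeff_eq0.
  by apply: contra nle => /yle /frobenius_exponent_le.
exists (\sum_i d i *: (tnth (in_tuple s) i).2).
  apply: ideal_sum => // i _; rewrite -mul_mpolyC; case: hI => _ _; apply.
  by apply: Is; apply: mem_tnth.
split=> [|a].
  by rewrite mcoeff_msupp hd ?eqxx ?oner_neq0 // mem_head.
move=> ha; apply/negP => /negP nle; have au : a != u.
  by apply: contraNneq nle => ->.
suff aT : a \in T by move: ha; rewrite mcoeff_msupp hd // (negPf au) eqxx.
rewrite inE mem_filter nle /=; apply/orP; right.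
have /flattenP[_ /mapP[i _ ->] hi] := msupp_sum_le ha.
apply/flattenP; exists (msupp (tnth (in_tuple s) i).2).
  by apply: map_f; apply: mem_tnth.
exact: msuppZ_le hi.
Qed.

(** * Initial exponents of an ideal with a large colon *)

Context (I : {mpoly K[n]} -> Prop) (hI : is_ideal I).
Context (hin : initial_exponent le (colon (frobenius_power p I) I)
                 (frobenius_exponent p 0)).

(** For f in I^[p] : I of initial exponent rho and g in I of initial exponent
    p u, the product f g is in I^[p] and its initial exponent is rho + p u. *)
Lemma initial_exponent_root (u : 'X_{1..n}) :
  initial_exponent le I (u *+ p)%MM -> initial_exponent le I u.
Proof.
case: hin => f hf f0 [g Ig gu].
apply: (@initial_frobenius_span _ _ (f * g)) => //.
  by apply: frobenius_power_span => //; apply: hf.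
by rewrite -[u]add0m frobenius_exponentD; apply: is_initialM.
Qed.

(** The power of p only has to bound every entry of m; since k < p^k, the
    power p^(mdeg m) is large enough. *)
Lemma initial_exponent_radical (m : 'X_{1..n}) :
  initial_exponent le I m -> initial_exponent le I (radical_mnm m).
Proof.
move=> hm.
have : initial_exponent le I (radical_mnm m *+ p ^ mdeg m)%MM.
  apply: initial_exponent_le hm => //; apply/mnm_lepP => i.
  rewrite mulmnE mnmE; case: (eqVneq (m i) 0%N) => [->//|_]; rewrite mul1n.
  apply: (@leq_trans (mdeg m)); first by rewrite mdegE (bigD1 i) //= leq_addr.
  by apply/ltnW/ltn_expl/prime_gt1/(pcharf_prime hp).
elim: (mdeg m) => [|k IH]; first by rewrite expn0 mulm1n.
rewrite expnSr => h; apply: IH; apply: initial_exponent_root.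
suff -> : (radical_mnm m *+ p ^ k *+ p = radical_mnm m *+ (p ^ k * p))%MM by [].
by apply/mnmP => i; rewrite !mulmnE mulnA.
Qed.

End Order.
End Frobenius.

Theorem theorem3p12 (K : fieldType) (p : nat) (hp : p \in [pchar K]) (n : nat)
    (I : {mpoly K[n]} -> Prop) (hI : is_ideal I)
    (le : rel 'X_{1..n}) (hle : monomial_order le)
    (hin : initial_ideal le (colon (frobenius_power p I) I)
             (\prod_(i < n) 'X_i ^+ p.-1)) :
  squarefree_monomial_ideal (initial_ideal le I).
Proof.
have hin0 : initial_exponent le (colon (frobenius_power p I) I)
                 (frobenius_exponent p 0).
  apply: initial_ideal_exponent => //.
    by apply: colon_ideal; apply: ideal_gen_ideal.
  suff <- : \prod_(i < n) 'X_i ^+ p.-1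
            = 'X_[frobenius_exponent p 0] :> {mpoly K[n]} by [].
  rewrite mpolyXE_id; apply: eq_bigr => i _.
  by rewrite mnmE mnm0E mul0n addn0.
exists (fun m => squarefree_mnm m /\ initial_exponent le I m).
split=> [m []//|f]; split; apply: ideal_gen_min; try exact: ideal_gen_ideal.
  move=> _ [g [m [Ig gm ->]]].
  rewrite -(submK (radical_mnm_le m)) mpolyXD.
  have [_ _] := ideal_gen_ideal
    (fun g => exists2 m, squarefree_mnm m /\ initial_exponent le I m
                         & g = 'X_[m] :> {mpoly K[n]}).
  apply; apply: ideal_gen_sub; exists (radical_mnm m) => //; split.
    exact: radical_mnm_squarefree.
  by apply: (initial_exponent_radical hp hle hI hin0); exists g.
move=> _ [m [_ [g Ig gm]] ->]; apply: ideal_gen_sub.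
by exists g, m.
Qed.
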